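(* There exists a transient locally finite graph on which homomorphisms are delocalized.
   Context: A graph is locally finite if every vertex has finite degree, and transient if the simple random walk on it is transient. A homomorphism on a graph $G$ is a function $\phi:V(G)\to\mathbb{Z}$ with $|\phi(u)-\phi(v)|=1$ for every edge $(u,v)$. On an infinite locally finite graph, one fixes a vertex $v^*$, sets zero boundary conditions (the height is fixed to be $0$ on the boundary) at increasing distances from $v^*$, and considers the height $\phi(v^* )$ of a uniformly random homomorphism $\phi$ on the resulting finite graph subject to this boundary condition. Homomorphisms are delocalized if the probability that $\phi(v^* )$ belongs to any given bounded set vanishes as the boundary recedes to infinity. *)

(* Defs.v *)
From HB Require Import structures.
From mathcomp Require Import all_boot all_order all_algebra finmap.
From mathcomp Require Import all_classical all_reals all_analysis.

Set Implicit Arguments.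
Unset Strict Implicit.
Unset Printing Implicit Defensive.

Import Order.TTheory GRing.Theory Num.Theory.
Import numFieldNormedType.Exports.

Local Open Scope classical_set_scope.
Local Open Scope ring_scope.

Record sgraph := SGraph {
  vertex :> choiceType;
  adj : rel vertex;
  adj_sym : symmetric adj;
  adj_irr : irreflexive adj }.

Section Graph.
Variable G : sgraph.

Definition neighbors (x : G) : set G := [set y | adj x y].

Definition locally_finite : Prop := forall x : G, finite_set (neighbors x).

Definition degree (x : G) : nat := #|` fset_set (neighbors x)|%fset.

Definition connected_graph : Prop :=
  forall x y : G, exists2 p : seq G, path (@adj G) x p & last x p = y.

Definition graph_ball (x : G) (n : nat) : set G :=
  [set y | exists p : seq G,
     [/\ path (@adj G) x p, last x p = y & (size p <= n)%N]].

Definition graph_sphere (x : G) (n : nat) : set G :=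
  [set y | graph_ball x n y /\ forall k, graph_ball x k y -> (n <= k)%N].

End Graph.

Section SimpleRandomWalk.
Variables (R : realType) (G : sgraph).

Definition srw_step (x y : G) : R :=
  if adj x y then (degree x)%:R^-1 else 0.

Definition is_srw (d : measure_display) (T : measurableType d)
    (P : probability T R) (X : nat -> T -> G) (x : G) : Prop :=
  (forall (n : nat) (y : G), measurable [set w | X n w = y]) /\
  (forall (n : nat) (s : nat -> G),
     P [set w | forall i, (i <= n)%N -> X i w = s i] =
     ((s 0%N == x)%:R * \prod_(i < n) srw_step (s i) (s i.+1))%:E).

(* The probability of return is determined by the cylinder probabilities in
   [is_srw], so it does not depend on the realization of the walk.  Asking for
   one realization (rather than quantifying over all of them) avoids vacuity. *)
Definition transient : Prop :=
  forall x : G,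
    exists (d : measure_display) (T : measurableType d)
           (P : probability T R) (X : nat -> T -> G),
      is_srw P X x /\ (P [set w | exists n, X n.+1 w = x] < 1)%E.

End SimpleRandomWalk.

Section Homomorphisms.
Variables (R : realType) (G : sgraph).

(* Homomorphisms on the subgraph induced by [D] with value 0 on [B]; a function
   on [D] is encoded as a function on [G] that is 0 outside [D]. *)
Definition homs (D B : set G) : set (G -> int) :=
  [set phi | [/\ forall u v, D u -> D v -> adj u v -> `|phi u - phi v| = 1,
                 forall u, B u -> phi u = 0
               & forall u, ~ D u -> phi u = 0]].

Definition ball_homs (x : G) (n : nat) : set (G -> int) :=
  homs (graph_ball x n) (graph_sphere x n).

Definition uniform_hom_prob (H E : set (G -> int)) : R :=
  #|` fset_set (H `&` E)|%fset%:R / #|` fset_set H|%fset%:R.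

(* [fset_set] and division are total, so [uniform_hom_prob] is 0 when there is no
   homomorphism (e.g. if [G] is not bipartite) or infinitely many: the first two
   conditions make the uniform law well defined. *)
Definition delocalized : Prop :=
  forall x : G,
    [/\ forall n, ball_homs x n !=set0,
        forall n, finite_set (ball_homs x n)
      & forall A : set int, (exists M : int, forall a, A a -> `|a| <= M) ->
          uniform_hom_prob (ball_homs x n) [set phi | A (phi x)]
            @[n --> \oo] --> (0 : R)].

End Homomorphisms.

(* Main.v *)
Require Import Defs.
From mathcomp Require Import all_boot all_order all_algebra finmap.
From mathcomp Require Import all_classical all_reals all_analysis.
From mathcomp Require Import measurable_realfun ring lra zify.

(** The graph is a half-line of complete bipartite layers [V_0], [V_1], ...,
    where each [V_j] is also joined completely to a pendant set [W_j] of hubs,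
    and the sizes grow superexponentially in the order
    [V_0], [W_0], [V_1], [W_1], ....

    Transience: from [V_j] the walk steps to [V_(j+1)] with probability at least
    [1 - 2^-(2j+2)], so with positive probability it marches outward forever.

    Delocalization: if a homomorphism is not constant on [V_j], then all
    neighbours of [V_j] share one height; flattening [V_j] frees every vertex of
    [W_j], which is larger than [V_j], so this has probability at most [2^-j].
    On the event that [V_J], ..., [V_(J+K)] are all flat, each of the [K] height
    steps between consecutive layers can be reversed independently by shifting
    everything inside, so the inner height is a sum of [K] fair signs given the
    rest and has atoms of size at most the central binomial probability. *)

Set Implicit Arguments.
Unset Strict Implicit.
Unset Printing Implicit Defensive.

Import Order.TTheory GRing.Theory Num.Theory.
Import numFieldNormedType.Exports.

Local Open Scope classical_set_scope.
Local Open Scope ring_scope.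

(** * Existence of the simple random walk *)

Lemma probability_setI1 (R : realType) (d : measure_display)
    (T : measurableType d) (P : probability T R) (A B : set T) :
  measurable A -> measurable B -> P B = 1%E -> P A = P (A `&` B).
Proof.
move=> mA mB PB1; rewrite -[in LHS](setUIDK A B) measureU//; last 3 first.
- exact: measurableI.
- exact: measurableD.
- by rewrite setDE setIACA setICr setI0.
rewrite [X in (_ + X)%E](_ : _ = 0%E) ?adde0//.
apply/eqP; rewrite eq_le measure_ge0 andbT.
apply: (@le_trans _ _ (P (~` B))).
  by apply: le_measure; rewrite ?inE; 
    [exact: measurableD|exact: measurableC|move=> u []].
by rewrite probability_setC// PB1 subee.
Qed.

Section WalkConstruction.
Variables (R : realType) (G : sgraph).
Hypotheses (locfin : locally_finite G) (deg_gt0 : forall x : G, (0 < degree x)%N).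

(** One uniform seed drives the whole walk: the integer part of degree times seed selects the next
    vertex, and the fractional part is a fresh seed. The default of [nth] can only matter for seeds
    outside [[0, 1)]. *)
Definition walk_step (q : G * R) : G * R :=
  let v := (degree q.1)%:R * q.2 in
  (nth q.1 (fset_set (neighbors q.1)) (Num.truncn v), v - (Num.truncn v)%:R).

Definition walk (x : G) (n : nat) (u : R) : G := (iter n walk_step (x, u)).1.

Lemma walkS x n u :
  walk x n.+1 u = let q := walk_step (x, u) in walk q.1 n q.2.
Proof. by rewrite /walk iterSr -surjective_pairing. Qed.

Lemma measurable_walk x n y : measurable [set u : R | walk x n u = y].
Proof.
elim: n x => [|n IH] x.
  rewrite /walk /=; case: (pselect (x = y)) => [->|nxy].
    by rewrite (_ : [set _ | _] = setT)//; apply/seteqP; split.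
  by rewrite (_ : [set _ | _] = set0)// -subset0 => u /nxy.
pose d := degree x; pose v (u : R) := d%:R * u.
(* [Num.truncn] sends every negative number to 0, so the fibre over 0 is a ray and not [[0, 1)]. *)
have vE i : [set u : R | Num.truncn (v u) = i] =
    v @^-1` [set` if i == 0%N then `]-oo, 1[ else `[i%:R, i.+1%:R[].
  apply/seteqP; split => u /=.
    move=> <-; case: eqP => [t0|/eqP t0]; rewrite in_itv /=.
      by have := real_truncnS_gt (num_real (v u)); rewrite t0.
    apply: truncn_itv; rewrite leNgt; apply: contra t0 => v0.
    by rewrite truncn_floor leNgt v0.
  case: eqP => [->|_]; rewrite in_itv /=; last exact: truncn_def.
  case: (ltP (v u) 0) => [v0|v0] v1; first by rewrite truncn_floor leNgt v0.
  by apply: truncn_def; rewrite v0.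
have mv : measurable_fun [set: R] v by apply: mulrl_measurable.
rewrite (_ : [set u | _] = \bigcup_i ([set u : R | Num.truncn (v u) = i] `&`
   (fun u => v u - i%:R) @^-1`
     [set w | walk (nth x (fset_set (neighbors x)) i) n w = y])).
  apply: bigcupT_measurable => i; apply: measurableI.
    rewrite vE; have := mv measurableT _ (measurable_itv
      (if i == 0%N then `]-oo, 1[ else `[i%:R, i.+1%:R[)).
    by rewrite setTI.
  have mvi : measurable_fun [set: R] (fun u => v u - i%:R).
    by apply: measurable_funB => //; exact: measurable_cst.
  by have := mvi measurableT _ (IH (nth x (fset_set (neighbors x)) i)); rewrite setTI.
apply/seteqP; split => u /=; rewrite walkS /=.
  by move=> wy; exists (Num.truncn (v u)).
by move=> [i _ [/= <-]].
Qed.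

(** A prescribed initial trajectory corresponds to a half-open interval of seeds whose length is its
    probability. Prepending a step shifts the interval of the remaining trajectory by the index of
    the chosen neighbour and divides it by the degree. *)
Lemma walk_cylinder x n (s : nat -> G) : s 0%N = x ->
  exists a b : R, [/\ 0 <= a, a <= b, b <= 1,
    b - a = \prod_(i < n) srw_step R (s i) (s i.+1) &
    forall u : R, 0 <= u < 1 ->
      (forall i, (i <= n)%N -> walk x i u = s i) <-> a <= u < b].
Proof.
elim: n x s => [|n IH] x s s0.
  exists 0, 1; split => //; first by rewrite big_ord0 subr0.
  move=> u u01; split=> [_|_ i]; first by [].
  by rewrite leqn0 => /eqP ->; rewrite s0.
have [a [b [a0 ab b1 eab Hab]]] := IH (s 1%N) (s \o S) erefl.
have finN := locfin x.
case: (boolP (adj x (s 1%N))) => xs1; last first.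
  (* For a seed in [[0, 1)] the selected index is below the degree, so the walk never crosses a
     non-edge and the interval is empty. *)
  exists 0, 0; split => //; rewrite ?subrr.
    by rewrite big_ord_recl /srw_step /= s0 (negbTE xs1) mul0r.
  move=> u /andP[u0 u1]; split; last by move=> /andP[/le_lt_trans/[apply]]; rewrite ltxx.
  move=> /(_ 1%N isT); rewrite walkS /walk /= => ws.
  exfalso; move: xs1; rewrite -ws; apply/negP/negPn.
  set k := Num.truncn _.
  have kd : (k < degree x)%N.
    rewrite /k truncn_lt_nat ?mulr_ge0//.
    by rewrite gtr_pMr// ltr0n.
  have := mem_nth x kd.
  by rewrite in_fset_set// inE.
pose d := degree x.
pose i0 := index (s 1%N) (fset_set (neighbors x)).
have i0d : (i0 < d)%N.
  by rewrite /d /degree index_mem in_fset_set// inE.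
have ni0 : nth x (fset_set (neighbors x)) i0 = s 1%N.
  by rewrite nth_index// in_fset_set// inE.
have dgt0 : 0 < d%:R :> R by rewrite ltr0n (leq_ltn_trans _ i0d).
exists ((i0%:R + a) / d%:R), ((i0%:R + b) / d%:R); split.
- by rewrite divr_ge0// addr_ge0.
- by rewrite ler_pM2r ?invr_gt0// lerD2l.
- rewrite ler_pdivrMr// mul1r (@le_trans _ _ (i0.+1%:R))//; last by rewrite ler_nat.
  by rewrite -natr1 lerD2l.
- rewrite -mulrBl [_ - _](_ : _ = b - a); last by lra.
  by rewrite eab big_ord_recl /= mulrC /srw_step s0 xs1.
move=> u /andP[u0 u1].
rewrite ler_pdivrMr// ltr_pdivlMr// [u * _]mulrC -/d.
set v := d%:R * u.
have v0 : 0 <= v by rewrite mulr_ge0// ltW.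
have := truncn_itv v0; set k := Num.truncn v => kv.
have kd : (k < d)%N.
  by rewrite /k truncn_lt_nat// gtr_pMr.
have vk : 0 <= v - k%:R < 1.
  by move: kv; rewrite -natr1 => /andP[? ?]; apply/andP; split; lra.
have wE i : walk x i.+1 u = walk (nth x (fset_set (neighbors x)) k) i (v - k%:R).
  by rewrite walkS.
split.
- move=> H.
  have ki : k = i0.
    have := H 1%N isT; rewrite wE /walk /= -ni0 => /eqP.
    by rewrite nth_uniq ?fset_uniq// => /eqP.
  have [P _] := Hab _ vk.
  have {P} : a <= v - k%:R < b.
    by apply: P => i iln; rewrite /= -(H i.+1)// wE ki ni0.
  by rewrite ki => /andP[? ?]; apply/andP; split; lra.
- move=> Hv.
  have ki : k = i0.
    apply: truncn_def; rewrite -natr1.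
    by apply/andP; split; case/andP: Hv => ? ?; lra.
  have Q : a <= v - k%:R < b.
    by rewrite ki; case/andP: Hv => ? ?; apply/andP; split; lra.
  move=> [|i] iln; first by rewrite /walk /= s0.
  by rewrite wE ki ni0 -ki; apply: (proj2 (Hab _ vk)).
Qed.

Lemma uniform_prob_itvco (a b : R) : 0 <= a -> a <= b -> b <= 1 ->
  uniform_prob (@ltr01 R) `[a, b[%classic = (b - a)%:E.
Proof.
move=> a0 ab b1; rewrite /uniform_prob.
under eq_integral => u.
  rewrite inE /= in_itv /= => /andP[au ub].
  rewrite /uniform_pdf (le_trans a0 au) (le_trans (ltW ub) b1) /= subr0 invr1.
  over.
rewrite integral_cst//= mul1e lebesgue_measure_itv /= lte_fin.
have [ltab|] := ltP a b; first by rewrite EFinB.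
by move=> ba; rewrite (@le_anti _ _ a b) ?subrr// ab ba.
Qed.

Lemma srw_exists (x : G) :
  exists (d : measure_display) (T : measurableType d)
         (P : probability T R) (X : nat -> T -> G), is_srw P X x.
Proof.
exists _, (measurableTypeR R), (uniform_prob (@ltr01 R)), (walk x).
split; first by move=> n y; exact: measurable_walk.
move=> n s.
have mS : measurable
    [set u : measurableTypeR R | forall i, (i <= n)%N -> walk x i u = s i].
  rewrite (_ : [set _ | _] = \bigcap_(i in `I_n.+1) [set u | walk x i u = s i]).
    by apply: bigcap_measurable; [exists 0%N|move=> i _; exact: measurable_walk].
  by apply/seteqP; split => u /= H i /=; [move=> ?; apply: H|move=> ?; apply: H].
case: eqP => [s0|s0]; last first.
  rewrite mul0r (_ : [set _ | _] = set0) ?measure0//.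
  by rewrite -subset0 => u /(_ 0%N isT) /esym.
rewrite mul1r.
(* [walk_cylinder] only describes seeds in [[0, 1)], which carry the whole mass. *)
rewrite (@probability_setI1 _ _ (measurableTypeR R) _ _ (`[0, 1[%classic : set R))//;
  last first.
  by rewrite /= uniform_prob_itvco// subr0.
have [a [b [a0 ab b1 <- Hab]]] := walk_cylinder n s0.
rewrite -uniform_prob_itvco//; congr (uniform_prob _ _).
apply/seteqP; split => u /=; rewrite !in_itv /=.
  by move=> [H u01]; apply/(Hab _ u01).
move=> uab; have u01 : 0 <= u < 1.
  by case/andP: uab => au ub; rewrite (le_trans a0 au) (lt_le_trans ub b1).
by split => //; apply/(Hab _ u01).
Qed.

End WalkConstruction.

(** * Forward paths and the return probability *)

Section ForwardPaths.
Variables (R : realType) (G : sgraph) (fwd : G -> seq G) (rk : G -> nat).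
Hypotheses (fwd_uniq : forall x, uniq (fwd x))
  (rk_fwd : forall x y, y \in fwd x -> (rk x < rk y)%N).

Fixpoint fpaths (n : nat) (x : G) : seq (seq G) :=
  if n is m.+1 then [seq y :: p | y <- fwd x, p <- fpaths m y] else [:: [::]].

Fixpoint pweight (x : G) (p : seq G) : R :=
  if p is y :: q then srw_step R x y * pweight y q else 1.

(** By [forward_prob], this is the probability that the first [n] steps of the walk from [x] are all
    forward. *)
Definition fweight (n : nat) (x : G) : R := \sum_(p <- fpaths n x) pweight x p.

Lemma fweightS n x :
  fweight n.+1 x = \sum_(y <- fwd x) srw_step R x y * fweight n y.
Proof.
rewrite /fweight /= big_allpairs_dep; apply: eq_bigr => y _.
by rewrite big_distrr.
Qed.

Lemma fpaths_uniq n x : uniq (fpaths n x).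
Proof.
elim: n x => [//|n IH] x /=.
apply: allpairs_uniq_dep => //=.
by move=> [y p] [z q] _ _ [/= ->]; move=> ->.
Qed.

Lemma fpathsP n x p : p \in fpaths n x ->
  size p = n /\ {in p, forall z, (rk x < rk z)%N}.
Proof.
elim: n x p => [|n IH] x p /=; first by rewrite inE => /eqP ->.
move=> /allpairsPdep[y [q [yx /IH[sq rq] ->]]]; split; first by rewrite /= sq.
move=> z; rewrite inE => /predU1P[->|/rq]; first exact: rk_fwd.
exact/ltn_trans/rk_fwd.
Qed.

Lemma pweightE x p :
  pweight x p = \prod_(i < size p)
     srw_step R (nth x (x :: p) i) (nth x (x :: p) i.+1).
Proof.
elim: p x => [|y q IH] x; first by rewrite big_ord0.
rewrite /= big_ord_recl IH; congr (_ * _); apply: eq_bigr => i _ /=.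
by case: i => -[|i] /= lti; rewrite -!(set_nth_default y x)// ltnW.
Qed.

Section Walk.
Context (d : measure_display) (T : measurableType d) (P : probability T R).
Variables (X : nat -> T -> G) (x : G).
Hypothesis srwX : is_srw P X x.

Definition follows (p : seq G) : set T :=
  [set w | forall i, (i <= size p)%N -> X i w = nth x (x :: p) i].

Lemma measurable_follows p : measurable (follows p).
Proof.
rewrite (_ : follows p =
  \bigcap_(i in `I_(size p).+1) [set w | X i w = nth x (x :: p) i]).
  by apply: bigcap_measurable; [exists 0%N|move=> i _; exact: srwX.1].
by apply/seteqP; split => w /= H i /=; [move=> ?; apply: H|move=> ?; apply: H].
Qed.

Definition forward (n : nat) : set T := \big[setU/set0]_(p <- fpaths n x) follows p.

Lemma measurable_forward n : measurable (forward n).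
Proof. by apply: bigsetU_measurable => p _; exact: measurable_follows. Qed.

Lemma forward_prob n : P (forward n) = (fweight n x)%:E.
Proof.
rewrite /forward /fweight -sumEFin.
have : forall s : seq (seq G), uniq s -> {subset s <= fpaths n x} ->
    P (\big[setU/set0]_(p <- s) follows p) = (\sum_(p <- s) (pweight x p)%:E)%E.
  elim=> [|p s IH] /=; first by rewrite !big_nil measure0.
  move=> /andP[ps us] sub; rewrite !big_cons measureU//; last 3 first.
  - exact: measurable_follows.
  - by apply: bigsetU_measurable => q _; exact: measurable_follows.
  (* Forward paths of the same length followed by the same trajectory coincide, so distinct ones
     give disjoint events. *)
  - rewrite -subset0 => w [/= wp]; rewrite -bigcup_seq => -[q /= qs wq].
    have [sp _] := fpathsP (sub p (mem_head _ _)).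
    have qn : q \in fpaths n x by apply: sub; rewrite inE qs orbT.
    have [sq _] := fpathsP qn.
    suff pq : p = q by rewrite pq qs in ps.
    apply: (@eq_from_nth _ x); first by rewrite sp sq.
    move=> i ip; have := wp i.+1 ip; rewrite /= => <-.
    by have := wq i.+1; rewrite /= => -> //; rewrite sq -sp.
  congr (_ + _)%E; last by apply: IH => // q qs; apply: sub; rewrite inE qs orbT.
  have := srwX.2 (size p) (nth x (x :: p)); rewrite eqxx mul1r -pweightE => <-.
  by [].
by apply => //; exact: fpaths_uniq.
Qed.

Lemma forward_no_return n w : forward n w -> forall i, (i < n)%N -> X i.+1 w <> x.
Proof.
rewrite /forward -bigcup_seq => -[p /= /fpathsP[sp rp] wp] i lin.
rewrite wp ?sp//= => npx.
have ip : (i < size p)%N by rewrite sp.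
by have := rp _ (mem_nth x ip); rewrite npx ltnn.
Qed.

(** Forward steps strictly increase [rk], so [N] of them in a row exclude a return up to time [N].
    The return event is the increasing limit over [N]. *)
Lemma return_prob_le (c : R) : (forall n, c <= fweight n x) ->
  (P [set w | exists n, X n.+1 w = x] <= (1 - c)%:E)%E.
Proof.
move=> cf; pose F N : set T := \bigcup_(n in `I_N) [set w | X n.+1 w = x].
have mF N : measurable (F N).
  by apply: bigcup_measurable => n _; exact: srwX.1.
have -> : [set w | exists n, X n.+1 w = x] = \bigcup_N F N.
  apply/seteqP; split => w /=; last by move=> [N _ [n _ wn]]; exists n.
  by move=> [n wn]; exists n.+1 => //; exists n => /=.
have ndF : nondecreasing_seq F.
  move=> m n mn; apply/subsetPset => w [k /= km wk]; exists k => //=.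
  exact: leq_trans mn.
have := nondecreasing_cvg_mu mF (bigcupT_measurable _ mF) ndF => /(_ _ P) cvF.
rewrite -(cvg_lim _ cvF)//; apply: lime_le.
  by apply/cvg_ex; eexists; exact: cvF.
near=> N => /=.
apply: (@le_trans _ _ (P (~` forward N))).
  apply: le_measure; rewrite ?inE//.
    by apply: measurableC; exact: measurable_forward.
  by move=> w [n /= nN wn] /forward_no_return/(_ n nN).
rewrite probability_setC ?forward_prob; last exact: measurable_forward.
by rewrite EFinB leeB// lee_fin.
Unshelve. all: by end_near. Qed.

End Walk.
End ForwardPaths.

(** * The hub graph *)

Lemma card_fset_set_seq_le (T : choiceType) (A : set T) (s : seq T) :
  A `<=` [set` s] -> (#|` fset_set A|%fset <= size s)%N.
Proof.
move=> As.
have finA : finite_set A by apply: sub_finite_set As _; exact: finite_seq.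
apply: (@leq_trans #|` [fset z in s]|%fset); last by rewrite card_fseq size_undup.
apply: fsubset_leq_card; apply/fsubsetP => z; rewrite in_fset_set// !inE.
exact: As.
Qed.

(** Consecutive sizes have a ratio of order [4 ^ (2 * i + 1)]. The outer successor makes [ord0]
    available in every layer. *)
Definition layer_size (i : nat) : nat := (4 ^ (i * i)).+1.

(** With [i = 2 * j], this is the surplus of [W_j] over [V_j] that makes non-flat layers rare. *)
Lemma layer_sizeD i : (layer_size i + i <= layer_size i.+1)%N.
Proof.
rewrite /layer_size (_ : i.+1 * i.+1 = i * i + i.*2.+1)%N; last by lia.
rewrite expnD expnS -mul2n [(4 ^ (2 * i))%N]expnM.
have : (i < (4 ^ 2) ^ i)%N by exact: ltn_expl.
have : (0 < 4 ^ (i * i))%N by rewrite expn_gt0.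
move: (4 ^ (i * i))%N ((4 ^ 2) ^ i)%N => a b a0 ib.
by apply: (@leq_trans (a.+1 + i * a)%N); [|]; nia.
Qed.

Lemma leq_layer_size i j : (i <= j)%N -> (layer_size i <= layer_size j)%N.
Proof. by move=> ij; rewrite ltnS leq_exp2l// leq_mul. Qed.

(** For even [i], the left-hand sizes are those of the non-forward neighbours of a spine vertex;
    they form at most a fraction [2 ^- (i + 2)] of the forward ones. *)
Lemma layer_size_growth i :
  (2 ^ i.+2 * (layer_size i.+1 + layer_size i.-2) <= layer_size i.+2)%N.
Proof.
have -> : (layer_size i.+2 = (4 ^ (i.+1 * i.+1) * (64 * (2 ^ i) ^ 4)).+1)%N.
  rewrite /layer_size (_ : i.+2 * i.+2 = i.+1 * i.+1 + (3 + i * 2))%N;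
    last by rewrite [LHS]mulSn mulnS; lia.
  rewrite !expnD; congr (_ * (_ * _)).+1%N.
  by rewrite -expnM -[4%N]/(2 ^ 2)%N -expnM; congr (_ ^ _)%N; lia.
have : (layer_size i.-2 <= layer_size i.+1)%N by apply: leq_layer_size; lia.
rewrite [layer_size i.+1]/layer_size [(2 ^ i.+2)%N]expnS [(2 ^ i.+1)%N]expnS.
have : (0 < 4 ^ (i.+1 * i.+1))%N by rewrite expn_gt0.
have : (0 < 2 ^ i)%N by rewrite expn_gt0.
move: (4 ^ _)%N (2 ^ i)%N (layer_size _) => a b c b0 a0 ca.
have bb : (b <= b * (b * (b * b)))%N by rewrite leq_pmulr// !muln_gt0 b0.
apply: (@leq_trans (2 * (2 * b) * (4 * a))%N); first by rewrite leq_mul//; lia.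
by apply: leqW; rewrite (_ : 2 * (2 * b) * (4 * a) = a * (16 * b))%N ?leq_mul//; lia.
Qed.

(* The tag [2 * j] is the spine layer [V_j] and the tag [2 * j + 1] is the hub
   layer [W_j], joined to [V_j] only. *)
Definition vertices : choiceType := {i : nat & 'I_(layer_size i)}.

Definition vtx (i : nat) (c : 'I_(layer_size i)) : vertices :=
  Tagged (fun i => 'I_(layer_size i)) c.

Definition tag_arc (i j : nat) : bool :=
  ~~ odd i && ((j == i.+1) || (j == i.+2)).

Definition tag_adj (i j : nat) : bool := tag_arc i j || tag_arc j i.

Definition layer_adj : rel vertices := fun x y => tag_adj (tag x) (tag y).

Lemma layer_adj_sym : symmetric layer_adj.
Proof. by move=> x y; rewrite /layer_adj /tag_adj orbC. Qed.

Lemma layer_adj_irr : irreflexive layer_adj.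
Proof. by move=> x; rewrite /layer_adj /tag_adj /tag_arc; apply/negbTE; lia. Qed.

Definition hub_graph : sgraph := SGraph layer_adj_sym layer_adj_irr.

Definition layer (i : nat) : seq hub_graph := [seq vtx c | c <- enum 'I_(layer_size i)].

Lemma size_layer i : size (layer i) = layer_size i.
Proof. by rewrite size_map size_enum_ord. Qed.

Lemma mem_layer i (x : hub_graph) : (x \in layer i) = (tag x == i).
Proof.
apply/mapP/eqP => [[c _ ->]//|<-].
by exists (tagged x); rewrite ?mem_enum//; case: x.
Qed.

Lemma layer_uniq i : uniq (layer i).
Proof. by rewrite map_inj_uniq ?enum_uniq// => a b /eqP; rewrite eq_Tagged => /eqP. Qed.

Lemma finite_tag_le t : finite_set [set x : hub_graph | (tag x <= t)%N].
Proof.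
apply: sub_finite_set (finite_seq (flatten [seq layer i | i <- iota 0 t.+1])).
move=> x xt; apply/flatten_mapP; exists (tag x); last by rewrite mem_layer.
by rewrite mem_iota.
Qed.

Lemma tag_adj_le i j : tag_adj i j -> (j <= i.+2)%N.
Proof. by rewrite /tag_adj /tag_arc; lia. Qed.

Lemma hub_graph_locally_finite : locally_finite hub_graph.
Proof.
move=> x; apply: sub_finite_set (finite_tag_le (tag x).+2) => y.
exact: tag_adj_le.
Qed.

Lemma hub_graph_infinite : infinite_set [set: hub_graph].
Proof.
move=> /(finite_image (fun x : hub_graph => tag x)) /sub_finite_set fT.
apply: infinite_nat; apply: fT => i _ /=.
by exists (vtx (ord0 : 'I_(layer_size i))).
Qed.

Definition fwd_tag (i : nat) : nat := if odd i then i.-1 else i.+2.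

Definition fwd (x : hub_graph) : seq hub_graph := layer (fwd_tag (tag x)).

(** The tag itself drops when the walk goes forward from a hub to its spine layer; this rank places
    [W_j] just below [V_j] and so increases along every forward step. *)
Definition fwd_rank (x : hub_graph) : nat :=
  if odd (tag x) then (tag x).-1 else (tag x).+1.

Lemma fwd_rank_fwd x y : y \in fwd x -> (fwd_rank x < fwd_rank y)%N.
Proof.
rewrite mem_layer /fwd_tag /fwd_rank => /eqP ->.
by case: ifP => o; case: ifP => o'; lia.
Qed.

Lemma tag_adj_fwd i : tag_adj i (fwd_tag i).
Proof. by rewrite /tag_adj /tag_arc /fwd_tag; case: ifP; lia. Qed.

Lemma degree_gt0 (x : hub_graph) : (0 < degree x)%N.
Proof.
rewrite /degree cardfs_gt0; apply/fset0Pn.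
exists (vtx (ord0 : 'I_(layer_size (fwd_tag (tag x))))).
rewrite in_fset_set ?inE; last exact: hub_graph_locally_finite.
exact: tag_adj_fwd.
Qed.

Lemma degree_hub (x : hub_graph) : odd (tag x) ->
  (degree x <= layer_size (tag x).-1)%N.
Proof.
move=> ox; rewrite -size_layer; apply: card_fset_set_seq_le => y /=.
rewrite mem_layer /neighbors /= /layer_adj /tag_adj /tag_arc.
by move: (tag x) (tag y) ox => i j; lia.
Qed.

(** At tag 0 the truncated subtraction lists layer 0 itself, which only weakens the upper bound. *)
Lemma degree_spine (x : hub_graph) : ~~ odd (tag x) ->
  (degree x <= layer_size (tag x).+2 +
                 (layer_size (tag x).+1 + layer_size (tag x).-2))%N.
Proof.
move=> ex; rewrite -!size_layer -!size_cat; apply: card_fset_set_seq_le => y /=.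
rewrite !mem_cat !mem_layer /neighbors /= /layer_adj /tag_adj /tag_arc.
by move: (tag x) (tag y) ex => i j; lia.
Qed.

(** * Transience of the hub graph *)

Section Transience.
Variable R : realType.

Lemma half_exprS_le k : 2^-1 ^+ k.+1 <= 2^-1 :> R.
Proof. by rewrite exprS ler_piMr// exprn_ile1// invf_le1// ler1n. Qed.

Lemma srw_step_fwd (x y : hub_graph) : y \in fwd x ->
  srw_step R x y = (degree x)%:R^-1.
Proof.
rewrite mem_layer /srw_step => /eqP yx.
by rewrite [adj x y](_ : _ = true)//= /layer_adj yx tag_adj_fwd.
Qed.

Lemma fweight_hub_graphS n x (c : R) :
  (forall y, y \in fwd x -> c <= fweight R fwd n y) ->
  (degree x)%:R^-1 * c *+ layer_size (fwd_tag (tag x)) <= fweight R fwd n.+1 x.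
Proof.
move=> Hc; rewrite fweightS -size_layer -iter_addr_0 -count_predT -big_const_seq.
rewrite big_seq [leRHS]big_seq.
by apply: ler_sum => y yx; rewrite srw_step_fwd// ler_wpM2l ?Hc.
Qed.

(** With [e = 2 ^- (i + 2)] for [i] the tag, the first step fails to be forward with probability at
    most [e], and so do the later steps together, by induction at tag [i + 2]. The two losses add up
    to [2 ^- (i + 1)]. *)
Lemma fweight_spine n (x : hub_graph) : ~~ odd (tag x) ->
  1 - 2^-1 ^+ (tag x).+1 <= fweight R fwd n x.
Proof.
elim: n x => [|n IH] x ex.
  by rewrite /fweight /= big_seq1 /= lerBlDr lerDl exprn_ge0.
set i := tag x.
apply: le_trans (fweight_hub_graphS (c := 1 - 2^-1 ^+ i.+2) _); last first.
  move=> y; rewrite mem_layer /fwd_tag (negbTE ex) => /eqP ty.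
  apply: le_trans (IH y _); last by rewrite ty /= negbK.
  by rewrite lerD2l lerN2 ty ler_wiXn2l// invf_le1// ler1n.
rewrite /fwd_tag (negbTE ex) -/i.
have := degree_spine ex; rewrite -/i.
have := layer_size_growth i; have := degree_gt0 x.
move: (degree x) (layer_size i.+2) (_ + _)%N => d a b d0 ba dab.
set e : R := 2^-1 ^+ i.+2.
have e01 : 0 <= e <= 1 by rewrite exprn_ge0//= exprn_ile1// invf_le1// ler1n.
have eS : 2^-1 ^+ i.+1 = 2 * e by rewrite /e [in RHS]exprS mulrA divff ?mul1r.
have be : b%:R <= e * a%:R.
  by rewrite /e exprVn ler_pdivlMl ?exprn_gt0// -natrX -natrM ler_nat.
have de : d%:R <= a%:R + b%:R :> R by rewrite -natrD ler_nat.
have d0' : 0 < d%:R :> R by rewrite ltr0n.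
have e2 : e <= 2^-1.
  exact: half_exprS_le.
have a0 : 0 <= a%:R :> R by [].
rewrite eS -[_ *+ a]mulr_natr -mulrA ler_pdivlMl// [d%:R * _]mulrC.
move: (d%:R : R) (a%:R : R) (b%:R : R) be de d0' a0 => {d0 ba dab a b d}d a b be de d0 a0.
(* This rests on [(1 - 2 * e) * (1 + e) <= 1 - e]. *)
apply: (@le_trans _ _ ((1 - 2 * e) * (a + e * a))); last by nra.
by apply: ler_wpM2l; lra.
Qed.

(** A hub steps to its own spine layer with certainty, so a start at a hub reduces to a start on the
    spine. *)
Lemma fweight_ge_half n (x : hub_graph) : 2^-1 <= fweight R fwd n x.
Proof.
have half y : ~~ odd (tag y) -> forall m, 2^-1 <= fweight R fwd m y.
  move=> ey m; apply: le_trans (fweight_spine m ey).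
  by have := half_exprS_le (tag y); lra.
have [ox|ex] := boolP (odd (tag x)); last exact: half.
case: n => [|n].
  by rewrite /fweight /= big_seq1 /= invf_le1// ler1n.
apply: le_trans (fweight_hub_graphS (c := 2^-1) _); last first.
  by move=> y; rewrite mem_layer => /eqP ty; apply: half; rewrite ty /fwd_tag ox; lia.
rewrite /fwd_tag ox -[_ *+ layer_size _]mulr_natr mulrAC ler_peMl//.
rewrite ler_pdivlMl ?ltr0n ?degree_gt0//.
by rewrite mulr1 ler_nat degree_hub.
Qed.

Lemma hub_graph_transient : transient R hub_graph.
Proof.
move=> x; have [d [T [P [X srwX]]]] :=
  srw_exists R hub_graph_locally_finite degree_gt0 x.
exists d, T, P, X; split => //.
have lu y : uniq (fwd y) by exact: layer_uniq.
apply: le_lt_trans (return_prob_le lu fwd_rank_fwd srwX (c := 2^-1) _) _.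
  by move=> n; exact: fweight_ge_half.
by rewrite lte_fin; lra.
Qed.

End Transience.

(** * Homomorphisms on balls *)

Lemma int_dist_succ (a b c : int) (n : nat) :
  `|c - b| = 1 -> `|a - b| <= n%:Z -> `|a - c| <= n.+1%:Z.
Proof. lia. Qed.

Lemma int_dist_double (a b : int) (n : nat) :
  `|a - b| <= n%:Z -> `|0 - b| <= n%:Z -> `|a| <= n.*2%:Z.
Proof. lia. Qed.

Lemma int_shift_range (a : int) (n : nat) : `|a| <= n%:Z ->
  (absz (a + n%:Z)%R < n.*2.+1)%N /\ (absz (a + n%:Z))%:Z - n%:Z = a.
Proof. lia. Qed.

Section BallHomomorphisms.
Variable G : sgraph.

Lemma graph_ball_le (x y : G) m n : (m <= n)%N ->
  graph_ball x m y -> graph_ball x n y.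
Proof. by move=> mn [p [xp <- sp]]; exists p; split=> //; exact: leq_trans mn. Qed.

Lemma graph_sphereP (x y : G) n : graph_sphere x n y ->
  exists p, [/\ path (@adj G) x p, last x p = y & size p = n].
Proof.
move=> [[p [xp <- sp]] min]; exists p; split => //.
apply/eqP; rewrite eqn_leq sp min//; by exists p.
Qed.

Lemma hom_path_lip (D B : set G) phi x p : homs D B phi ->
  D x -> {in p, forall z, D z} -> path (@adj G) x p ->
  `|phi (last x p) - phi x| <= (size p)%:Z.
Proof.
move=> [lip _ _]; elim: p x => [|y p IH] x Dx Dp; first by rewrite subrr.
rewrite [path _ _ _]/= [last _ _]/= [size _]/= => /andP[xy yp].
have Dy : D y by apply: Dp; rewrite mem_head.
have Dp' : {in p, forall z, D z} by move=> z zp; apply: Dp; rewrite inE zp orbT.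
have := IH y Dy Dp' yp; have := lip _ _ Dx Dy xy.
move=> h1 h2; exact: int_dist_succ h1 h2.
Qed.

Lemma graph_ball_path (x : G) p n : path (@adj G) x p -> (size p <= n)%N ->
  {in x :: p, forall z, graph_ball x n z}.
Proof.
move=> xp pn z zp; case/splitPl: p / zp xp pn => p1 p2 p1z.
rewrite cat_path size_cat => /andP[xp1 _] pn; exists p1; split=> //.
by apply: leq_trans pn; rewrite leq_addr.
Qed.

(** Both [u] and the zero of [phi] at [y] are within distance [n] of [x], and [phi] is 1-Lipschitz
    along paths in the ball. *)
Lemma ball_hom_bound (x y : G) n phi : graph_sphere x n y ->
  ball_homs x n phi -> forall u, graph_ball x n u -> `|phi u| <= n.*2%:Z.
Proof.
move=> sy hphi u [p [xp <- pn]].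
have lip q : path (@adj G) x q -> (size q <= n)%N -> `|phi (last x q) - phi x| <= n%:Z.
  move=> xq qn; have Dq := graph_ball_path xq qn.
  apply: le_trans (hom_path_lip hphi _ _ xq) _; last by rewrite lez_nat.
    by apply: Dq; rewrite mem_head.
  by move=> z zq; apply: Dq; rewrite inE zq orbT.
have [q [xq eq sq]] := graph_sphereP sy.
have := lip q xq; rewrite sq leqnn => /(_ isT).
have phiq : phi (last x q) = 0 by case: hphi => _ z _; apply: z; rewrite eq.
by rewrite phiq => qx; exact: int_dist_double (lip p xp pn) qx.
Qed.

Lemma finite_bounded_functions (D : set G) (M : nat) (H : set (G -> int)) :
  finite_set D ->
  (forall phi, H phi -> forall u, D u -> `|phi u| <= M%:Z) ->
  (forall phi, H phi -> forall u, ~ D u -> phi u = 0) -> finite_set H.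
Proof.
move=> finD bnd out.
pose S := fset_set D.
pose F (f : {ffun S -> 'I_(M.*2).+1}) (u : G) : int :=
  if insub u is Some v then (f v)%:Z - M%:Z else 0.
apply: (@sub_finite_set _ _ (F @` [set: _])); last exact/finite_image/finite_finset.
move=> phi Hphi; exists [ffun v : S => inord (absz (phi (val v) + M%:Z))] => //.
apply/funext => u; rewrite /F; case: insubP => [v uS <-|].
  have Du : D (val v) by move: (valP v); rewrite in_fset_set// inE.
  by have [lt eq] := int_shift_range (bnd _ Hphi _ Du); rewrite ffunE inordK.
by rewrite in_fset_set// notin_setE => /out ->.
Qed.

Lemma colour_path (colour : G -> bool) :
  (forall u v, adj u v -> colour v = ~~ colour u) ->
  forall x p, path (@adj G) x p -> colour (last x p) = colour x (+) odd (size p).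
Proof.
move=> flip x p; elim: p x => [|y p IH] x /=; first by rewrite addbF.
by move=> /andP[/flip cy /IH ->]; rewrite cy; case: (colour x); case: odd.
Qed.

Lemma ball_homs_nonempty (colour : G -> bool) :
  (forall u v, adj u v -> colour v = ~~ colour u) ->
  forall (x : G) n, ball_homs x n !=set0.
Proof.
move=> flip x n.
(* The bipartition gives a homomorphism with values 0 and 1; [colour x (+) odd n] is the colour of
   the whole sphere, which receives 0. *)
exists (fun u => if `[< graph_ball x n u >] then
                   (colour u != colour x (+) odd n : nat)%:Z else 0).
split=> [u v /asboolT -> /asboolT -> /flip ->|u /graph_sphereP[p [xp pu sp]]|u Du].
- by case: (colour u); case: (_ (+) _).
- rewrite asboolT; last by exists p; rewrite sp.
  by rewrite -pu (colour_path flip xp) sp eqxx.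
- by rewrite asboolF.
Qed.

(** Climbing [n] times raises [h] by [n], and the Lipschitz bound shows that no shorter path reaches
    that height. A point of the sphere anchors the heights, which makes the set of homomorphisms
    finite. *)
Lemma graph_sphere_nonempty (h : G -> nat) :
  (forall u v, adj u v -> (h v <= (h u).+1)%N) ->
  (forall u, exists2 v, adj u v & h v = (h u).+1) ->
  forall (x : G) n, graph_sphere x n !=set0.
Proof.
move=> lip up x n.
have hpath y p : path (@adj G) y p -> (h (last y p) <= h y + size p)%N.
  elim: p y => [|z p IH] y /=; first by rewrite addn0.
  by move=> /andP[/lip yz /IH]; lia.
have [y [p [xp py sp]] hy] : exists2 y, graph_ball x n y & h y = (h x + n)%N.
  elim: n => [|n [y [p [xp <- sp]] hy]].
    by exists x; [exists [::]|rewrite addn0].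
  have [v yv hv] := up (last x p); exists v; last by rewrite hv hy addnS.
  by exists (rcons p v); rewrite rcons_path xp last_rcons size_rcons.
exists y; split; first by exists p.
by move=> k [q [xq qy qk]]; have := hpath _ _ xq; rewrite qy hy; lia.
Qed.

Lemma finite_ball_homs (x : G) n : finite_set (graph_ball x n) ->
  graph_sphere x n !=set0 -> finite_set (ball_homs x n).
Proof.
move=> finD [y sy].
apply: (finite_bounded_functions finD) => phi hphi; first exact: ball_hom_bound sy hphi.
by case: hphi.
Qed.

Lemma eventually_inside_ball (x : G) (S : set G) : connected_graph G ->
  finite_set S -> exists n0, forall n, (n0 <= n)%N ->
    forall u, S u -> graph_ball x n u /\ ~ graph_sphere x n u.
Proof.
move=> conn /finite_seqP[s ->].
suff [n0 Hn0] : exists n0, forall u, u \in s -> graph_ball x n0 u.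
  (* One extra unit of radius keeps the set off the sphere. *)
  exists n0.+1 => n n0n u /= /Hn0 un0; split.
    by apply: graph_ball_le un0; exact: ltnW.
  by move=> [_ /(_ _ un0)]; rewrite leqNgt n0n.
elim: s => [|v s [n0 IH]]; first by exists 0%N.
have [p xp pv] := conn x v; exists (maxn n0 (size p)) => u.
rewrite inE => /predU1P[->|/IH]; first by exists p; rewrite leq_maxr.
by apply: graph_ball_le; rewrite leq_maxl.
Qed.

End BallHomomorphisms.

(** * Connectedness, balls and ball homomorphisms of the hub graph *)

Lemma hub_graph_connected : connected_graph hub_graph.
Proof.
pose conn (x y : hub_graph) := exists2 p : seq hub_graph,
  path (@adj hub_graph) x p & last x p = y.
have trans x y z : conn x y -> conn y z -> conn x z.
  move=> [p xp py] [q yq qz]; exists (p ++ q); last by rewrite last_cat py.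
  by rewrite cat_path xp py.
have edge (x y : hub_graph) : adj x y -> conn x y.
  by move=> xy; exists [:: y] => //=; apply/andP.
have sym x y : conn x y -> conn y x.
  move=> [p]; elim: p x => [|z p IH] x /=; first by move=> _ ->; exists [::].
  move=> /andP[xz zp] /(IH _ zp) yz; apply: trans yz _.
  by apply: edge; rewrite adj_sym.
(* Descending through the tags ends in [V_0], which has no inner edges but is completely joined to
   [V_1]; hence a root of tag 2. *)
pose r : hub_graph := vtx (ord0 : 'I_(layer_size 2)).
suff toroot x : conn x r by move=> x y; apply: trans (toroot x) (sym _ _ (toroot y)).
have [n] := ubnP (tag x); elim: n x => // n IH x xn.
have [t0|t0] := posnP (tag x).
  by apply: edge; rewrite /= /layer_adj t0.
pose i := if odd (tag x) then (tag x).-1 else (tag x).-2.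
have ix : (i < tag x)%N by rewrite /i; case: ifP; lia.
apply: (trans _ (vtx (ord0 : 'I_(layer_size i)))); last first.
  by apply: IH => /=; lia.
apply: edge; rewrite /= /layer_adj /= /tag_adj /tag_arc /i.
by move: (tag x) t0 => k k0; case: ifP; lia.
Qed.

Lemma hub_graph_finite_ball (x : hub_graph) n : finite_set (graph_ball x n).
Proof.
apply: sub_finite_set (finite_tag_le (tag x + n.*2)) => y [p [xp <- pn]].
apply: (@leq_trans (tag x + (size p).*2)); last by rewrite leq_add2l leq_double.
elim: p {pn y} x xp => [|y p IH] x /=; first by rewrite addn0.
move=> /andP[/tag_adj_le xy /IH yp]; apply: (leq_trans yp).
by rewrite doubleS !addnS -!addSn leq_add2r.
Qed.

Lemma hub_graph_ball_homs (x : hub_graph) n :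
  ball_homs x n !=set0 /\ finite_set (ball_homs x n).
Proof.
split.
  (* This is the parity of [j] on [V_j] and of [j + 1] on [W_j]. *)
  pose colour (u : hub_graph) := odd (uphalf (tag u)).
  apply: (@ball_homs_nonempty hub_graph colour _ x n) => u v; rewrite /colour.
  by rewrite /= /layer_adj /tag_adj /tag_arc; move: (tag u) (tag v) => i j; lia.
apply: finite_ball_homs (hub_graph_finite_ball x n) _.
(* A forward step raises this 1-Lipschitz height by one. *)
pose h (u : hub_graph) := if odd (tag u) then (tag u)./2 else (tag u)./2.+1.
apply: (@graph_sphere_nonempty hub_graph h _ _ x n) => [u v|u].
  rewrite /= /layer_adj /tag_adj /tag_arc /h; move: (tag u) (tag v) => i j.
  by case: ifP; case: ifP; lia.
exists (vtx (ord0 : 'I_(layer_size (fwd_tag (tag u))))); first exact: tag_adj_fwd.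
rewrite /h /= /fwd_tag; case: (boolP (odd (tag u))) => o; case: ifP; lia.
Qed.

(** * Counting *)

Lemma bin_le_central m t : ('C(m.*2, t) <= 'C(m.*2, m))%N.
Proof.
have low s : (s <= m)%N -> ('C(m.*2, m - s) <= 'C(m.*2, m))%N.
  elim: s => [|s IH] sm; first by rewrite subn0.
  apply: leq_trans (IH (ltnW sm)).
  have := mul_bin_left m.*2 (m - s.+1).
  rewrite (_ : (m - s.+1).+1 = m - s)%N; last by lia.
  move: 'C(_, _) 'C(_, _) => a b e.
  by rewrite -(leq_pmul2l (_ : 0 < m - s)%N) ?e ?leq_mul//; lia.
have [tm|tm] := leqP t m; first by rewrite -(subKn tm); exact/low/leq_subr.
have [t2|t2] := leqP t m.*2; last by rewrite bin_small.
by rewrite -bin_sub// (_ : m.*2 - t = m - (t - m))%N; [apply: low|]; lia.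
Qed.

(** In other words, the central probability is at most [1 / sqrt (2m + 1)]. The induction step comes
    down to [(2m + 1) (2m + 3) <= 4 (m + 1)^2]. *)
Lemma central_bin_le m : ('C(m.*2, m) ^ 2 * m.*2.+1 <= 16 ^ m)%N.
Proof.
elim: m => [//|m IH].
have e : (m.+1 * 'C(m.+1.*2, m.+1) = 2 * (m.*2.+1 * 'C(m.*2, m)))%N.
  have := mul_bin_diag m.+1.*2 m; rewrite doubleS /= => <-.
  have : ('C(m.*2.+1, m) * m.+1 = m.*2.+1 * 'C(m.*2, m))%N.
    have := mul_bin_down m.*2.+1 m; rewrite /= => e3.
    by move: e3; rewrite mulnC (_ : m.*2.+1 - m = m.+1)%N; lia.
  by rewrite (_ : m.*2.+2 = 2 * m.+1)%N; [move=> e4; rewrite -e4|]; lia.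
rewrite -(@leq_pmul2l (m.+1 ^ 2)) ?expn_gt0// mulnA -expnMn e [(16 ^ _)%N]expnS.
move: IH; move: 'C(m.*2, m) (16 ^ m)%N => c a IH.
rewrite doubleS !expnMn.
apply: (@leq_trans ((c ^ 2 * m.*2.+1) * (4 * (m.*2.+1 * m.*2.+3)))%N).
  by rewrite !expnS expn0 !muln1; lia.
apply: (@leq_trans (a * (4 * (m.*2.+1 * m.*2.+3)))%N); first by rewrite leq_mul.
by rewrite [leqRHS]mulnA [leqRHS]mulnC leq_mul// !expnS expn0 muln1; lia.
Qed.

(* The recursion is that of [k] fair coins of value 2, solved by Pascal's rule. *)
Lemma coin_recursion (g : nat -> int -> nat) (K : nat) (a : int) :
  (forall k c, (k < K)%N -> (2 * g k c <= g k.+1 c + g k.+1 (c - 2)%R)%N) ->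
  forall k, (k <= K)%N ->
    (2 ^ k * g 0%N a <= \sum_(t < k.+1) 'C(k, t) * g k (a - 2 * t%:Z)%R)%N.
Proof.
move=> Hg; elim=> [|k IH] kK.
  by rewrite big_ord_recl big_ord0 /= bin0 !mul1n addn0 mulr0 subr0.
rewrite expnS -mulnA.
apply: (@leq_trans (2 * \sum_(t < k.+1) 'C(k, t) * g k (a - 2 * t%:Z)%R)%N).
  by rewrite leq_mul2l IH// ltnW.
rewrite big_distrr /=.
apply: (@leq_trans (\sum_(t < k.+1) 'C(k, t) *
    (g k.+1 (a - 2 * t%:Z)%R + g k.+1 (a - 2 * t.+1%:Z)%R))%N).
  apply: leq_sum => t _; rewrite mulnCA leq_mul2l; apply/orP; right.
  rewrite (_ : a - 2 * t.+1%:Z = a - 2 * t%:Z - 2); first exact: Hg.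
  by lia.
under [leqLHS]eq_bigr do rewrite mulnDr.
rewrite big_split /= [in leqRHS]big_ord_recl /=.
under [in leqRHS]eq_bigr do rewrite /bump /= binS mulnDl.
rewrite big_split /= addnA leq_add2r.
rewrite big_ord_recl /= bin0 leq_add// big_ord_recr /= bin_small// mul0n addn0.
by apply: leq_sum => t _; rewrite /bump.
Qed.

Section Counting.
Variables (T : eqType) (L : seq T).
Hypothesis uniqL : uniq L.

Lemma count_le_inj (P Q : pred T) (f : T -> T) :
  {in L, forall z, P z -> (f z \in L) && Q (f z)} ->
  {in [pred z | (z \in L) && P z] &, injective f} -> (count P L <= count Q L)%N.
Proof.
move=> PQ injf; rewrite -2!size_filter -(size_map f); apply: uniq_leq_size.
  rewrite map_inj_in_uniq ?filter_uniq// => y z.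
  by rewrite !mem_filter => /andP[Py yL] /andP[Pz zL]; apply: injf; rewrite inE ?yL ?zL.
move=> _ /mapP[z + ->]; rewrite !mem_filter => /andP[Pz zL].
by have /andP[-> ->] := PQ z zL Pz.
Qed.

Lemma count_disjoint_le (I : finType) (P : pred T) (Q : I -> pred T) :
  (forall i z, z \in L -> Q i z -> P z) ->
  (forall i j z, Q i z -> Q j z -> i = j) ->
  (\sum_i count (Q i) L <= count P L)%N.
Proof.
move=> QP disj; rewrite -[count P L]sum1_count [leqRHS]big_mkcond /=.
under [leqLHS]eq_bigr do rewrite -sum1_count big_mkcond /=.
rewrite exchange_big /= big_seq [leqRHS]big_seq; apply: leq_sum => z zL.
have [/existsP[i Qi]|/existsPn none] := boolP [exists i, Q i z]; last first.
  by rewrite big1// => i _; rewrite (negbTE (none i)).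
rewrite (QP i z zL Qi) (bigD1 i)//= Qi big1// => j ji.
by case: ifP => // Qj; rewrite (disj _ _ _ Qi Qj) eqxx in ji.
Qed.

Lemma count_sum_ge (I : finType) (P : pred T) (Q : I -> pred T) :
  (forall z, z \in L -> P z -> exists i, Q i z) ->
  (count P L <= \sum_i count (Q i) L)%N.
Proof.
move=> PQ; rewrite -[count P L]sum1_count [leqLHS]big_mkcond /=.
under [leqRHS]eq_bigr do rewrite -sum1_count big_mkcond /=.
rewrite [leqRHS]exchange_big /= big_seq [leqRHS]big_seq; apply: leq_sum => z zL.
case: ifP => // /(PQ z zL)[i Qi]; rewrite (bigD1 i)//= Qi.
exact: leq_addr.
Qed.

End Counting.

(** * Flat layers and reflected steps *)

Lemma int_dist1P (a b : int) : `|a - b| = 1 -> a - b = 1 \/ a - b = -1.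
Proof. lia. Qed.

Lemma int_midpoint (a b v w : int) : a <> b ->
  `|v - a| = 1 -> `|v - b| = 1 -> `|w - a| = 1 -> `|w - b| = 1 -> v = w.
Proof. lia. Qed.

Lemma int_shift_bool_inj (h : int) (a b : bool) :
  h + 2 * (a : nat)%:Z = h + 2 * (b : nat)%:Z -> a = b.
Proof. by case: a; case: b => //= e; exfalso; lia. Qed.

Definition spine (phi : hub_graph -> int) (j : nat) : int :=
  phi (vtx (ord0 : 'I_(layer_size j.*2))).

Definition flat (phi : hub_graph -> int) (j : nat) : Prop :=
  forall u : hub_graph, tag u = j.*2 -> phi u = spine phi j.

Definition step_down (phi : hub_graph -> int) (j : nat) : int :=
  spine phi j - spine phi j.+1.

(** The cut-off moves [W_j] along with [V_j], so only edges between [V_j] and [V_(j+1)] have their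
    ends shifted differently. *)
Definition reflect_step (j : nat) (phi : hub_graph -> int) : hub_graph -> int :=
  fun u => if (tag u <= j.*2.+1)%N then phi u - 2 * step_down phi j else phi u.

Lemma spine_reflect j phi i : spine (reflect_step j phi) i =
  if (i <= j)%N then spine phi i - 2 * step_down phi j else spine phi i.
Proof.
rewrite {1}/spine /reflect_step /= (_ : (i.*2 <= j.*2.+1)%N = (i <= j)%N)//.
by lia.
Qed.

Lemma step_down_reflect j phi i : (i <= j)%N ->
  step_down (reflect_step j phi) i =
  if i == j then - step_down phi j else step_down phi i.
Proof.
move=> ij; rewrite {1}/step_down !spine_reflect ij; case: eqP => [->|/eqP nij].
  by rewrite ltnn /step_down; ring.
by rewrite ltn_neqAle nij ij /= /step_down; ring.
Qed.

Lemma reflect_stepK j : involutive (reflect_step j).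
Proof.
move=> phi; apply/funext => u; rewrite {1}/reflect_step step_down_reflect// eqxx.
by rewrite /reflect_step; case: (_ <= _)%N => //; ring.
Qed.

Lemma flat_reflect j phi i : flat phi i -> flat (reflect_step j phi) i.
Proof.
move=> flati u tu; rewrite spine_reflect /reflect_step tu flati//.
by rewrite (_ : (i.*2 <= j.*2.+1)%N = (i <= j)%N)//; lia.
Qed.

Section Homomorphisms.
Variables (D B : set hub_graph) (t : nat) (L : seq (hub_graph -> int)).
Hypotheses (uniqL : uniq L)
  (memL : forall phi : hub_graph -> int, phi \in L <-> homs D B phi)
  (inside : forall u : hub_graph, (tag u <= t)%N -> D u /\ ~ B u).

Lemma homs_adj phi (u v : hub_graph) : homs D B phi ->
  (tag u <= t)%N -> (tag v <= t)%N ->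
  tag_adj (tag u) (tag v) -> `|phi u - phi v| = 1.
Proof. by move=> [lip _ _] /inside[Du _] /inside[Dv _]; exact: lip. Qed.

Lemma step_downP phi j : homs D B phi -> (j.*2.+2 <= t)%N ->
  step_down phi j = 1 \/ step_down phi j = -1.
Proof.
move=> hphi jt; apply/int_dist1P/(homs_adj hphi) => //=; first by lia.
by rewrite /tag_adj /tag_arc; lia.
Qed.

(** Flatness on both sides gives all crossing edges the same difference [step_down phi j], and the
    shift just reverses its sign. *)
Lemma homs_reflect phi j : homs D B phi -> flat phi j -> flat phi j.+1 ->
  (j.*2.+2 <= t)%N -> homs D B (reflect_step j phi).
Proof.
move=> hphi fj fj1 jt; have [lip zB zD] := hphi; split.
- have across (u v : hub_graph) : tag_adj (tag u) (tag v) -> (tag u <= j.*2.+1)%N ->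
      ~~ (tag v <= j.*2.+1)%N -> `|phi u - 2 * step_down phi j - phi v| = 1.
    move=> uv uj vj.
    have /andP[/eqP tu /eqP tv] : (tag u == j.*2) && (tag v == j.*2.+2).
      by move: uv uj vj; rewrite /tag_adj /tag_arc; move: (tag u) (tag v) => a b; lia.
    rewrite (fj _ tu) (fj1 v)// -/(step_down phi j).
    by case: (step_downP hphi jt); rewrite /step_down; lia.
  move=> u v Du Dv uv; rewrite /reflect_step; case: ifPn => uj; case: ifPn => vj.
  + by rewrite -(lip u v Du Dv uv); congr `|_|; ring.
  + exact: across.
  + by rewrite distrC; apply: across => //; rewrite /tag_adj orbC.
  + exact: lip.
- move=> u Bu; rewrite /reflect_step ifN ?zB//; apply/negP => uj.
  by have [|_] := inside (u := u); first exact: leq_trans uj (ltnW jt).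
- move=> u Du; rewrite /reflect_step ifN ?zD//; apply/negP => uj.
  by have [|] := inside (u := u); first exact: leq_trans uj (ltnW jt).
Qed.

(** * Non-flat layers are rare *)

Section NonFlat.
Variable j : nat.
Hypothesis jt : (j.*2.+2 <= t)%N.

(** A common neighbour of two vertices of different heights sits at their midpoint; every neighbour
    of [V_j] is common to all of [V_j]. *)
Lemma not_flat_adj phi (w : hub_graph) : homs D B phi -> ~ flat phi j ->
  tag_adj j.*2 (tag w) -> phi w = spine phi j.+1.
Proof.
move=> hphi /existsNP[u /not_implyP[tu neq]] jw.
have jw1 : tag_adj j.*2 j.*2.+2 by rewrite /tag_adj /tag_arc; lia.
have wt : (tag w <= t)%N by have := tag_adj_le jw; lia.
have jt' : (j.*2 <= t)%N by lia.
have tagC a b : tag_adj a b = tag_adj b a by rewrite /tag_adj orbC.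
by apply: (int_midpoint neq); apply: (homs_adj hphi); rewrite ?tu//= tagC.
Qed.

Lemma not_flat_spine phi (u : hub_graph) : homs D B phi -> ~ flat phi j ->
  tag u = j.*2 ->
  phi u = spine phi j.+1 + 1 \/ phi u = spine phi j.+1 - 1.
Proof.
move=> hphi nf tu.
have : `|phi u - spine phi j.+1| = 1.
  apply: (homs_adj hphi); rewrite ?tu//=; first by lia.
  by rewrite /tag_adj /tag_arc; lia.
by move/int_dist1P => -[/eqP|/eqP]; rewrite subr_eq addrC => /eqP; [left|right].
Qed.

(* Since [V_j] takes two values, its neighbours all have height [h]: flattening
   [V_j] to [h + 1] frees the heights [h], [h + 2] on [W_j], and the former
   pattern on [V_j] is recorded separately. *)
Definition free_hub (phi : hub_graph -> int)
    (om : {ffun 'I_(layer_size j.*2.+1) -> bool}) : hub_graph -> int :=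
  fun u => if tag u == j.*2 then spine phi j.+1 + 1 else
    if tag u == j.*2.+1 then spine phi j.+1 + 2 * (om (inord (tagged u)) : nat)%:Z
    else phi u.

Definition pattern (phi : hub_graph -> int) : {ffun 'I_(layer_size j.*2) -> bool} :=
  [ffun c => phi (vtx c) == spine phi j.+1 + 1].

Lemma free_hub_homs phi om : homs D B phi -> ~ flat phi j ->
  homs D B (free_hub phi om).
Proof.
move=> hphi nf; have [lip zB zD] := hphi.
have adjh := not_flat_adj hphi nf.
have near (u v : hub_graph) : tag_adj (tag u) (tag v) -> tag u = j.*2 ->
    `|free_hub phi om u - free_hub phi om v| = 1.
  move=> uv tu; have nvj : tag v == j.*2 = false.
    by apply/negbTE; move: uv; rewrite tu /tag_adj /tag_arc; lia.
  have tuj : tag u == j.*2 by apply/eqP.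
  rewrite /free_hub tuj nvj; case: ifP => _; first by case: (om _); lia.
  by rewrite adjh -?tu//; lia.
split.
- move=> u v Du Dv uv; have [/eqP tu|nu] := boolP (tag u == j.*2); first exact: near.
  have [/eqP tv|nv] := boolP (tag v == j.*2).
    by rewrite distrC; apply: near => //; rewrite /tag_adj orbC.
  have ne (w z : hub_graph) : tag_adj (tag w) (tag z) -> tag z != j.*2 ->
      tag w == j.*2.+1 = false.
    move=> wz nz; apply/negbTE; move: wz nz; rewrite /tag_adj /tag_arc.
    by move: (tag w) (tag z) => a b; lia.
  rewrite /free_hub (negbTE nu) (negbTE nv) (ne u v)// (ne v u) ?lip//.
  by rewrite /tag_adj orbC.
- move=> u Bu; have nut : ~~ (tag u <= t)%N by apply/negP => /inside[].
  by rewrite /free_hub !ifN ?zB//; apply: contra nut => /eqP ->; lia.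
- move=> u Du; have nut : ~~ (tag u <= t)%N by apply/negP => /inside[].
  by rewrite /free_hub !ifN ?zD//; apply: contra nut => /eqP ->; lia.
Qed.

(** The height [h] survives on [V_(j+1)]; the pattern then restores [V_j], whose heights are [h + 1]
    or [h - 1], and [W_j] was constantly [h]. *)
Lemma free_hub_inj phi psi om ro : homs D B phi -> ~ flat phi j ->
  homs D B psi -> ~ flat psi j ->
  free_hub phi om = free_hub psi ro -> pattern phi = pattern psi ->
  phi = psi /\ om = ro.
Proof.
move=> hphi nphi hpsi npsi efree epat.
have ev (u : hub_graph) : free_hub phi om u = free_hub psi ro u by rewrite efree.
have eh : spine phi j.+1 = spine psi j.+1.
  have := ev (vtx (ord0 : 'I_(layer_size j.+1.*2))).
  by rewrite /free_hub /= !ifN//; lia.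
split.
  apply/funext => u; have [/eqP tu|nu] := boolP (tag u == j.*2).
    have : pattern phi (cast_ord (congr1 layer_size tu) (tagged u)) =
           pattern psi (cast_ord (congr1 layer_size tu) (tagged u)) by rewrite epat.
    have eu : vtx (cast_ord (congr1 layer_size tu) (tagged u)) = u.
      case: u tu => k c /= tu; subst k.
      by congr vtx; apply: val_inj.
    rewrite !ffunE eu eh.
    have := not_flat_spine hphi nphi tu; have := not_flat_spine hpsi npsi tu.
    rewrite eh; move: (phi u) (psi u) (spine _ _) => a b c; lia.
  have [/eqP tu|nu1] := boolP (tag u == j.*2.+1).
    have a : tag_adj j.*2 (tag u) by rewrite tu /tag_adj /tag_arc; lia.
    by rewrite (not_flat_adj hphi nphi a) (not_flat_adj hpsi npsi a).
  by have := ev u; rewrite /free_hub (negbTE nu) (negbTE nu1).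
apply/ffunP => c; have := ev (vtx c).
rewrite /free_hub /= (gtn_eqF (ltnSn j.*2)) eqxx !inord_val eh => e.
exact: int_shift_bool_inj e.
Qed.

(** Injecting pairs (non-flat homomorphism, choice on [W_j]) into pairs (homomorphism, pattern on
    [V_j]) bounds the non-flat count times [2 ^ |W_j|] by [size L] times [2 ^ |V_j|], and
    [|W_j| >= |V_j| + j]. *)
Lemma count_not_flat :
  (2 ^ j * count (fun phi => ~~ `[< flat phi j >]) L <= size L)%N.
Proof.
pose A := [seq phi <- L | ~~ `[< flat phi j >]].
have AP phi : phi \in A -> homs D B phi /\ ~ flat phi j.
  by rewrite mem_filter => /andP[/asboolPn ? /memL].
pose f (q : (hub_graph -> int) * {ffun 'I_(layer_size j.*2.+1) -> bool}) :=
  (free_hub q.1 q.2, pattern q.1).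
pose s := [seq f (phi, om) |
  phi <- A, om <- enum {ffun 'I_(layer_size j.*2.+1) -> bool}].
have us : uniq s.
  apply: allpairs_uniq; rewrite ?enum_uniq ?filter_uniq//.
  move=> [phi om] [psi ro] /allpairsP[[a b] /= [/AP[hphi nphi] _ [-> ->]]].
  move=> /allpairsP[[c d] /= [/AP[hpsi npsi] _ [-> ->]]] [e1 e2].
  by have [-> ->] := free_hub_inj hphi nphi hpsi npsi e1 e2.
have ss : {subset s <= [seq (phi, p) |
    phi <- L, p <- enum {ffun 'I_(layer_size j.*2) -> bool}]}.
  move=> _ /allpairsP[[phi om] /= [/AP[hphi nphi] _ ->]].
  apply/allpairsP; exists (f (phi, om)) => /=; split; rewrite ?mem_enum//.
  by apply/memL; exact: free_hub_homs.
have := uniq_leq_size us ss.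
rewrite !size_allpairs -!cardE !card_ffun card_bool !card_ord size_filter => le.
have le2 : (2 ^ j * 2 ^ layer_size j.*2 <= 2 ^ layer_size j.*2.+1)%N.
  rewrite -expnD leq_exp2l//; apply: leq_trans (layer_sizeD _).
  by rewrite addnC leq_add2l; lia.
rewrite -(@leq_pmul2r (2 ^ layer_size j.*2)) ?expn_gt0//.
apply: leq_trans le; rewrite mulnAC mulnC leq_mul2l le2 orbT//.
Qed.

End NonFlat.

(** * Height distribution across a window of flat layers *)

Section Window.
Variables (x : hub_graph) (J m : nat).
Let K := m.*2.
Hypotheses (xJ : (tag x <= J.*2)%N) (JKt : ((J + K).*2.+2 <= t)%N).

Definition flat_window (phi : hub_graph -> int) : Prop :=
  forall i, (i <= K)%N -> flat phi (J + i).

(** The inner height with its first [k] coins removed. Adding 1 turns a step of size 1 or -1 into a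
    coin of value 2 or 0, as in [coin_recursion]. *)
Definition stripped_height (k : nat) (phi : hub_graph -> int) : int :=
  phi x - \sum_(i < k) (step_down phi (J + i) + 1).

Definition height_count (k : nat) (c : int) : nat :=
  count (fun phi => `[< flat_window phi >] && (stripped_height k phi == c)) L.

Lemma stripped_height_reflect k phi :
  stripped_height k.+1 (reflect_step (J + k) phi) = stripped_height k.+1 phi.
Proof.
rewrite /stripped_height !big_ord_recr /= step_down_reflect// eqxx.
under eq_bigr => i _.
  rewrite step_down_reflect; last by rewrite leq_add2l ltnW.
  rewrite ifN; last by rewrite eqn_add2l ltn_eqF.
  over.
rewrite /reflect_step (_ : (tag x <= _)%N = true); last by apply/idP; lia.
by ring.
Qed.

(** Removing coin [k] sends height [c] to [c] or [c - 2] according to its side. Reflecting that step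
    preserves [stripped_height k.+1] and swaps the sides, so each side is at most half of its
    count. *)
Lemma height_countS k c : (k < K)%N ->
  (2 * height_count k c <= height_count k.+1 c + height_count k.+1 (c - 2)%R)%N.
Proof.
move=> kK.
have jt : ((J + k).*2.+2 <= t)%N by lia.
(* [b = true] stands for a step of -1, that is, a coin of value 0. *)
pose S (c : int) (b : bool) (phi : hub_graph -> int) :=
  [&& `[< flat_window phi >], stripped_height k.+1 phi == c &
      step_down phi (J + k) == (-1) ^+ b].
have symS d b : (count (S d b) L <= count (S d (~~ b)) L)%N.
  apply: (count_le_inj uniqL (f := reflect_step (J + k))); last first.
    by move=> phi psi _ _; exact/can_inj/reflect_stepK.
  move=> phi /memL hphi /and3P[/asboolP fl /eqP Zd /eqP sd]; apply/andP; split.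
    apply/memL/homs_reflect => //; first exact/fl/ltnW.
    by rewrite -addnS; exact: fl.
  apply/and3P; split; last 2 first.
  - by rewrite stripped_height_reflect Zd.
  - by rewrite step_down_reflect// eqxx sd; case: b {sd}.
  by apply/asboolP => i iK; apply: flat_reflect; exact: fl.
have le2 d : (count (S d false) L + count (S d true) L <= height_count k.+1 d)%N.
  have := @count_disjoint_le _ L bool
    (fun phi => `[< flat_window phi >] && (stripped_height k.+1 phi == d)) (S d).
  rewrite big_bool addnC; apply=> [b phi _ /and3P[-> ->]//|b b' phi].
  by move=> /and3P[_ _ /eqP e] /and3P[_ _]; rewrite e; case: b {e}; case: b'.
have split_last :
    (height_count k c <= count (S c true) L + count (S (c - 2)%R false) L)%N.
  have := @count_sum_ge _ L bool
    (fun phi => `[< flat_window phi >] && (stripped_height k phi == c))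
    (fun b => S (if b then c else c - 2) b).
  rewrite big_bool; apply=> phi /memL hphi /andP[fl /eqP <-].
  case: (step_downP hphi jt) => sd; [exists false|exists true];
    by rewrite /S fl /stripped_height big_ord_recr /= sd ?expr0 ?expr1 eqxx andbT;
      apply/eqP; ring.
have := symS c true; have := symS (c - 2) false.
have := le2 c; have := le2 (c - 2); move: split_last => /=.
by lia.
Qed.

(** Each binomial weight of [coin_recursion] is replaced by the central one; the remaining counts
    concern distinct heights, so they sum to at most [size L]. *)
Lemma count_flat_window a :
  (2 ^ K * count (fun phi => `[< flat_window phi >] && (phi x == a)) L <=
   'C(K, m) * size L)%N.
Proof.
have -> : count (fun phi => `[< flat_window phi >] && (phi x == a)) L =
    height_count 0 a.
  by apply: eq_count => phi; rewrite /stripped_height big_ord0 subr0.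
apply: (leq_trans (coin_recursion a height_countS (leqnn K))).
apply: (@leq_trans (\sum_(i < K.+1) 'C(K, m) * height_count K (a - 2 * i%:Z)%R)%N).
  by apply: leq_sum => i _; rewrite leq_mul2r bin_le_central orbT.
rewrite -big_distrr leq_mul2l; apply/orP; right.
apply: leq_trans (count_size predT L); rewrite /height_count.
apply: (count_disjoint_le (L := L)
  (Q := fun (i : 'I_K.+1) phi => `[< flat_window phi >] &&
          (stripped_height K phi == a - 2 * i%:Z))) => //.
move=> i i' phi /andP[_ /eqP ->] /andP[_ /eqP e].
by apply/val_inj => /=; lia.
Qed.

(** A union bound: either the window is flat, or one of its [K + 1] layers fails, each with
    probability at most [2 ^- J]. *)
Lemma count_height_le (R : realType) (a : int) :
  (count (fun phi => phi x == a) L)%:R <=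
  ('C(K, m)%:R / 2 ^+ K + K.+1%:R / 2 ^+ J) * (size L)%:R :> R.
Proof.
have le : (count (fun phi => phi x == a) L <=
    count (fun phi => `[< flat_window phi >] && (phi x == a)) L +
    \sum_(i < K.+1) count (fun phi => ~~ `[< flat phi (J + i) >]) L)%N.
  pose P phi := `[< flat_window phi >] && (phi x == a).
  pose Q phi := [exists i : 'I_K.+1, ~~ `[< flat phi (J + i) >]].
  apply: (@leq_trans (count P L + count Q L)).
    rewrite -count_predUI; apply: leq_trans (leq_addr _ _).
    apply: sub_count => phi /= phia.
    have [fl|/existsNP[i /not_implyP[iK nf]]] := pselect (flat_window phi).
      by rewrite /P phia andbT; apply/orP; left; apply/asboolP.
    apply/orP; right; apply/existsP.
    by exists (Ordinal (iK : (i < K.+1)%N)); apply/asboolPn.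
  by rewrite leq_add2l; apply: count_sum_ge => phi _ /existsP.
apply: (@le_trans _ _ (_%:R)); first by rewrite ler_nat; exact: le.
rewrite natrD mulrDl lerD//.
  rewrite mulrAC ler_pdivlMr ?exprn_gt0// -natrX -!natrM ler_nat mulnC.
  exact: count_flat_window.
rewrite natr_sum -mulrA [_%:R * _]mulr_natl -[X in _ *+ X]card_ord -sumr_const.
apply: ler_sum => i _; rewrite mulrC ler_pdivlMr ?exprn_gt0// -natrX -natrM ler_nat mulnC.
apply: leq_trans (count_not_flat (j := J + i) _); last by have := ltn_ord i; lia.
by rewrite leq_mul2r leq_exp2l// leq_addr orbT.
Qed.

End Window.
End Homomorphisms.

(** * Delocalization *)

Lemma card_fset_setI_le (T : choiceType) (H P : set T) : finite_set H ->
  (#|` fset_set (H `&` P)|%fset <= count (fun z => `[< P z >]) (fset_set H))%N.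
Proof.
move=> finH; rewrite -size_filter; apply: uniq_leq_size; first exact: fset_uniq.
move=> z; rewrite in_fset_set; last exact: finite_setIl.
rewrite inE => -[Hz Pz]; rewrite mem_filter in_fset_set//.
by apply/andP; split; [apply/asboolP|rewrite inE].
Qed.

Lemma central_bin_small (R : realType) (d : R) : 0 < d ->
  exists m, 'C(m.*2, m)%:R / 2 ^+ m.*2 <= d.
Proof.
(* The bound [1 / sqrt (2m + 1)] is at most [d] once [m] exceeds [d ^- 2]. *)
move=> d0; exists (Num.bound (d ^- 2)); set m := Num.bound _.
have mP : d ^- 2 < m%:R.
  by apply: archi_boundP; rewrite invr_ge0 exprn_ge0// ltW.
set q : R := 2 ^+ m.*2; have q0 : 0 < q by rewrite exprn_gt0.
rewrite ler_pdivrMr// -(@ler_pXn2r _ 2) ?nnegrE ?(mulr_ge0 (ltW d0) (ltW q0))//.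
have := central_bin_le m; rewrite -(ler_nat R) natrM !natrX.
rewrite (_ : 16%:R ^+ m = q ^+ 2); last first.
  by rewrite -exprM -[m.*2]muln2 -mulnA mulnC exprM; congr (_ ^+ m); ring.
have m0 : 0 < m.*2.+1%:R :> R by rewrite ltr0n.
move=> le; rewrite -(ler_pM2r m0) exprMn; apply: le_trans le _.
rewrite mulrAC; apply: ler_peMl; first by rewrite exprn_ge0// ltW.
rewrite -ler_pdivrMl ?exprn_gt0// mulr1; apply: le_trans (ltW mP) _.
by rewrite ler_nat; lia.
Qed.

Lemma geometric_small (R : realType) (c d : R) (j : nat) : 0 <= c -> 0 < d ->
  exists2 J, (j <= J)%N & c / 2 ^+ J <= d.
Proof.
move=> c0 d0; exists (maxn j (Num.bound (c / d))); first exact: leq_maxl.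
set J := maxn _ _; rewrite ler_pdivrMr ?exprn_gt0// -ler_pdivrMl// mulrC.
have bP : c / d < (Num.bound (c / d))%:R by apply: archi_boundP; rewrite divr_ge0// ltW.
apply: le_trans (ltW bP) _; rewrite -natrX ler_nat.
by apply: leq_trans (leq_maxr j _) _; exact/ltnW/ltn_expl.
Qed.

Lemma hub_graph_delocalized (R : realType) : delocalized R hub_graph.
Proof.
move=> x; split; [by move=> n; case: (hub_graph_ball_homs x n)..|].
move=> A [M0 AM0]; pose M := absz M0.
apply/cvgr0Pnorm_lt => e e0.
(* There are [2M + 1] heights to sum over, each of probability at most [d + d]; the final [+ 1]
   makes the total strictly less than [e]. *)
pose d := e / (M.*2.+1%:R * 2 + 1).
have d0 : 0 < d by rewrite divr_gt0// ltr_wpDl// mulr_ge0.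
have [m md] := central_bin_small d0.
(* The window length is fixed first, because the union bound over its layers decides how far out [J]
   must lie. *)
have [J xJ Jd] := geometric_small (tag x) (ler0n R m.*2.+1) d0.
(* This is the tag of the spine layer just beyond the window, which the arguments about the last
   window layer still use. *)
pose t := (J + m.*2).*2.+2.
have [n0 inside] := eventually_inside_ball x hub_graph_connected (finite_tag_le t).
exists n0 => //= n /= /inside{}inside.
have [[phi0 hphi0] finH] := hub_graph_ball_homs x n.
set H := ball_homs x n in hphi0 finH *.
pose L : seq (hub_graph -> int) := fset_set H.
have memL (phi : hub_graph -> int) : phi \in L <-> H phi.
  by rewrite in_fset_set// inE.
have L0 : 0 < (size L)%:R :> R.
  by rewrite ltr0n; move/memL: hphi0 {memL}; case: L.
rewrite /uniform_hom_prob ger0_norm ?divr_ge0// ltr_pdivrMr//.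
have bound (a : int) :
    (count (fun phi => phi x == a) L)%:R <= (d + d) * (size L)%:R :> R.
  have xJ2 : (tag x <= J.*2)%N by apply: leq_trans xJ _; rewrite -addnn leq_addr.
  apply: le_trans (count_height_le (fset_uniq _) memL inside xJ2 (leqnn t) R a) _.
  by rewrite ler_pM2r// lerD.
apply: (@le_lt_trans _ _ (\sum_(i < M.*2.+1)
    (count (fun phi => phi x == i%:Z - M%:Z) L)%:R)).
  rewrite -natr_sum ler_nat; apply: leq_trans (card_fset_setI_le _ finH) _.
  apply: count_sum_ge => phi _ /asboolP/AM0 ax.
  have [lt eq] : (absz (phi x + M%:Z)%R < M.*2.+1)%N /\
      (absz (phi x + M%:Z))%:Z - M%:Z = phi x.
    by apply: int_shift_range; rewrite abszE; apply: le_trans ax _; exact: ler_norm.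
  by exists (Ordinal lt); rewrite /= eq.
apply: le_lt_trans (ler_sum _ (fun i _ => bound _)) _.
rewrite sumr_const card_ord -[_ *+ M.*2.+1]mulr_natl mulrA ltr_pM2r//.
have <- : d * (M.*2.+1%:R * 2 + 1) = e.
  by rewrite divfK// gt_eqF// ltr_wpDl// mulr_ge0.
by move: (M.*2.+1%:R : R) => N; lra.
Qed.

Theorem proposition5p2 (R : realType) :
  exists G : sgraph,
    [/\ infinite_set [set: G], connected_graph G, locally_finite G,
        transient R G & delocalized R G].
Proof.
exists hub_graph; split.
- exact: hub_graph_infinite.
- exact: hub_graph_connected.
- exact: hub_graph_locally_finite.
- exact: hub_graph_transient.
- exact: hub_graph_delocalized.
Qed.
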